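(* Let $G_1,G_2$ be chain graphs on the same finite vertex set $V$ and let $A\subseteq V$ be a common set of variables set by intervention, $x_a=a_0$ for every $a\in A$. If $(G_1,A)$ and $(G_2,A)$ are factorization-equivalent, then $G_1$ and $G_2$ admit the same factorization decomposition.
   Context: Chain graph: edges undirected ($u-w$) or directed ($u\to w$), no partially directed cycle. $pa(v)=\{u:u\to v\}$, $nb(v)=\{u:u-v\}$; chain components are connected components of the undirected edges; $pa(\tau)=\bigcup_{v\in\tau}pa(v)\setminus\tau$, $bd(\tau)=\bigcup_{v\in\tau}(pa(v)\cup nb(v))\setminus\tau$; $G_S$ induced subgraph; moral graph $K^m$ of chain graph $K$: $u,w$ adjacent iff adjacent in $K$ or both in $bd(\tau)$ for some chain component $\tau$ of $K$. Factorization with intervention: a probability density $f$ on $\times_{v\in V}\mathcal{X}_v$ (w.r.t. a product measure $\mu$) factorizes according to $G$ with $A$ intervened if every configuration with $x_a\ne a_0$ for some $a\in A$ has probability zero and $f(x\|x_A)=\prod_\tau f(x_{\tau\setminus A}\mid x_{pa(\tau)},x_{\tau\cap A})$ over chain components $\tau$ of $G$, where $f(x_{\tau\setminus A}\mid x_{pa(\tau)},x_{\tau\cap A})=Z^{-1}(x_{pa(\tau)},x_{\tau\cap A})\prod_{h\in\mathcal{C}}\psi_h(x)$, $\mathcal{C}$ the maximal cliques of $(G_{\tau\cup pa(\tau)})^m$, $\psi_h\ge0$ depending only on $x_h$, and $Z=\int_{\mathcal{X}_{\tau\setminus A}}\prod_{h\in\mathcal{C}}\psi_h\,d\mu_{\tau\setminus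 A}$. Two chain graphs admit the same factorization decomposition if every density that factorizes according to one also factorizes according to the other (here, with $A$ intervened). $(G_1,A)$ and $(G_2,A)$ are factorization-equivalent if deleting from each $G_i$ all vertices of $A$ together with all edges incident to them yields the same chain graph. *)

(* Defs.v *)
From HB Require Import structures.
From mathcomp Require Import all_boot all_order all_algebra.
From mathcomp Require Import all_classical all_reals all_analysis.
From mathcomp Require Import measurable_realfun.

Set Implicit Arguments.
Unset Strict Implicit.
Unset Printing Implicit Defensive.

Import Order.TTheory GRing.Theory Num.Theory.
Import numFieldNormedType.Exports.

Local Open Scope classical_set_scope.
Local Open Scope ring_scope.

(* The graph carries its vertex set, so that an induced subgraph is again a
   graph over V and "the same graph" is Leibniz equality.  An undirected edge
   u - w is stored as both (u, w) and (w, u); (u, w) \in dir G is u -> w. *)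
Record mixed_graph (V : finType) := MixedGraph {
  verts : {set V};
  und : {set V * V};
  dir : {set V * V}
}.

Section Graphs.
Context (V : finType).
Implicit Types (G K : mixed_graph V) (S T h A : {set V}).

Definition und_rel G : rel V := [rel u w | (u, w) \in und G].

Definition semi_rel G : rel V :=
  [rel u w | ((u, w) \in und G) || ((u, w) \in dir G)].

Definition adjacent G : rel V := [rel u w | semi_rel G u w || semi_rel G w u].

(* Every directed edge of a cycle c is some (u, next c u).  Cycles of length 1
   and 2 are included: they exclude u -> u, u -> w together with w -> u, and
   u -> w together with u - w. *)
Definition no_partially_directed_cycle G : Prop :=
  forall c : seq V, uniq c -> cycle (semi_rel G) c ->
  forall u, u \in c -> (u, next c u) \notin dir G.

Definition chain_graph G : Prop :=
  [/\ forall u w, semi_rel G u w -> (u \in verts G) && (w \in verts G),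
      symmetric (und_rel G),
      irreflexive (und_rel G)
    & no_partially_directed_cycle G].

Definition pa G (v : V) : {set V} := [set u | (u, v) \in dir G]%SET.
Definition nb G (v : V) : {set V} := [set u | (u, v) \in und G]%SET.

Definition parents G T : {set V} := ((\bigcup_(v in T) pa G v) :\: T)%SET.
Definition boundary G T : {set V} :=
  ((\bigcup_(v in T) (pa G v :|: nb G v)) :\: T)%SET.

Definition chain_components G : {set {set V}} :=
  equivalence_partition (connect (und_rel G)) (verts G).

Definition induced G S : mixed_graph V :=
  MixedGraph (verts G :&: S)%SET
    [set e in und G | (e.1 \in S) && (e.2 \in S)]%SET
    [set e in dir G | (e.1 \in S) && (e.2 \in S)]%SET.

Definition delete G A : mixed_graph V := induced G (verts G :\: A)%SET.

Definition moral_adjacent K : rel V :=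
  [rel u w | (u != w) && (adjacent K u w ||
     [exists T in chain_components K,
        (u \in boundary K T) && (w \in boundary K T)])].

Definition moral_clique K : pred {set V} :=
  fun h => (h \subset verts K) &&
    [forall u in h, forall w in h, (u != w) ==> moral_adjacent K u w].

Definition moral_max_cliques K : {set {set V}} :=
  [set h | maxset (moral_clique K) h]%SET.

Definition component_cliques G T : {set {set V}} :=
  moral_max_cliques (induced G (T :|: parents G T)%SET).

Definition factorization_equivalent G1 G2 A : Prop :=
  delete G1 A = delete G2 A.

End Graphs.

Section Config.
Context (V : finType) (d : V -> measure_display).
Variable X : forall v, measurableType (d v).

Definition cylinders : set (set (forall v, X v)) :=
  \bigcup_v preimage_set_system setT (fun x : forall v, X v => x v) measurable.

(* The product space of the X v, with the product sigma-algebra. *)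
Definition config := g_sigma_algebraType cylinders.

Lemma measurable_coord v : measurable_fun [set: config] (fun x => x v).
Proof.
move=> _ B mB; rewrite setTI; apply: sub_sigma_algebra.
by exists v => //; exists B => //; rewrite setTI.
Qed.

Lemma measurable_config d' (T : measurableType d') (g : T -> config) :
  (forall v, measurable_fun [set: T] (fun t => g t v)) ->
  measurable_fun [set: T] g.
Proof.
move=> mg; apply: (@measurability _ _ _ config _ _ cylinders) => //.
move=> _ [C [v _ [B mB <-]] <-].
have := mg v measurableT B mB; rewrite !setTI.
by congr (measurable _).
Qed.

Definition upd (x : config) v (y : X v) : config := dfwith x v y.

Lemma measurable_upd v :
  measurable_fun [set: config * X v] (fun p => upd p.1 p.2).
Proof.
apply: measurable_config => w; have [vw|vw] := eqVneq v w.
  subst w; suff -> : (fun p : config * X v => upd p.1 p.2 v) = snd.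
    exact: measurable_snd.
  by apply/funext => p; rewrite /upd dfwithin.
suff -> : (fun p : config * X v => upd p.1 p.2 w) = (fun p => p.1 w).
  exact: (measurableT_comp (@measurable_coord w) measurable_fst).
by apply/funext => p; rewrite /upd dfwithout.
Qed.

End Config.

Section ProductMeasure.
Context (R : realType) (V : finType) (d : V -> measure_display).
Context (X : forall v, measurableType (d v)).
Variable mu : forall v, {sigma_finite_measure set (X v) -> \bar R}.
Local Open Scope ereal_scope.
Implicit Types (s : seq V) (x : config X) (F : config X -> \bar R).

Fixpoint iterated_integral (s : seq V) (F : config X -> \bar R)
    (x : config X) : \bar R :=
  if s is v :: s' then \int[mu v]_y iterated_integral s' F (upd x y) else F x.

(* On the whole product space, the product of the mu v for v in S and of the
   point masses at x v for v outside S.  Thus \int[prod_measure S x]_y F y is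
   the integral of F over the coordinates in S with respect to the product of
   the mu v, the other coordinates being held fixed at those of x. *)
Definition prod_measure (S : {set V}) (x : config X) (U : set (config X)) :
  \bar R := iterated_integral (enum S) (fun y => (\1_U y)%:E) x.

Lemma iterated_integral_ge0 s F : (forall x, 0 <= F x) ->
  forall x, 0 <= iterated_integral s F x.
Proof.
by move=> F0; elim: s => [|v s IHs] x //=; apply: integral_ge0.
Qed.

Lemma measurable_iterated_integral s F : (forall x, 0 <= F x) ->
  measurable_fun [set: config X] F ->
  measurable_fun [set: config X] (iterated_integral s F).
Proof.
move=> F0 mF; elim: s => [//|v s IHs] /=.
apply: (@measurable_fun_fubini_tonelli_F _ _ (config X) (X v) R (mu v)
  (fun p => iterated_integral s F (upd p.1 p.2))).
- exact: (measurableT_comp IHs (@measurable_upd _ _ X v)).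
- by move=> p; exact: iterated_integral_ge0.
Qed.

Lemma measurable_iterated_integral_upd s F v x : (forall x, 0 <= F x) ->
  measurable_fun [set: config X] F ->
  measurable_fun [set: X v] (fun y => iterated_integral s F (upd x y)).
Proof.
move=> F0 mF; apply: (measurableT_comp (measurable_iterated_integral s F0 mF)).
exact: (measurableT_comp (@measurable_upd _ _ X v) (measurable_pair1 x)).
Qed.

Lemma iterated_integral_nneseries s (F : nat -> config X -> \bar R) :
  (forall n x, 0 <= F n x) -> (forall n, measurable_fun [set: config X] (F n)) ->
  forall x, iterated_integral s (fun y => \sum_(n <oo) F n y) x =
            \sum_(n <oo) iterated_integral s (F n) x.
Proof.
move=> F0 mF; elim: s => [//|v s IHs] x /=.
rewrite -integral_nneseries//; first by apply: eq_integral => y _; exact: IHs.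
- by move=> n; exact: measurable_iterated_integral_upd.
- by move=> n y _; exact: iterated_integral_ge0.
Qed.

Section Instance.
Variables (S : {set V}) (x : config X).

Let prod_measure0 : prod_measure S x set0 = 0.
Proof.
rewrite /prod_measure; elim: (enum S) x => [|v s IHs] z /=.
  by rewrite indic0.
by rewrite integral0_eq// => y _; exact: IHs.
Qed.

Let prod_measure_ge0 U : 0 <= prod_measure S x U.
Proof. by apply: iterated_integral_ge0 => z; rewrite lee_fin. Qed.

Let prod_measure_semi_sigma_additive : semi_sigma_additive (prod_measure S x).
Proof.
move=> U mU tU mUU.
rewrite [X in _ --> X](_ : _ = \sum_(n <oo) prod_measure S x (U n)).
  by apply: is_cvg_nneseries => n _ _; exact: prod_measure_ge0.
rewrite /prod_measure -iterated_integral_nneseries.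
- congr iterated_integral; apply/funext => y.
  rewrite -[LHS]/(dirac y (\bigcup_n U n)).
  exact/esym/cvg_lim/(measure_semi_sigma_additive _ mU tU mUU).
- by move=> n z; rewrite lee_fin.
- by move=> n; apply/measurable_EFinP; exact: measurable_indic.
Qed.

HB.instance Definition _ := isMeasure.Build _ _ R (prod_measure S x)
  prod_measure0 prod_measure_ge0 prod_measure_semi_sigma_additive.

End Instance.

Let iterated_integral_box (B : forall v, set (X v)) s x :
  (forall v, measurable (B v)) -> uniq s ->
  iterated_integral s
    (fun y => (\1_[set z : config X | forall v, B v (z v)] y)%:E) x =
  \prod_(v <- s) mu v (B v) * \prod_(v | v \notin s) dirac (x v) (B v).
Proof.
move=> mB; elim: s x => [|v s IHs] x /= us.
  rewrite big_nil mul1e indicE; case: (boolP (_ \in _)) => [|xB].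
    rewrite inE /= => xB; rewrite big1// => v _.
    by rewrite diracE mem_set.
  have [v vB] : exists v, ~ B v (x v).
    by apply/existsNP => h; move: xB; rewrite notin_setE; apply.
  by rewrite (bigD1 v)//= diracE memNset// mul0e.
case/andP: us => vs us.
under eq_integral => y _.
  rewrite IHs// (bigD1 v)//= diracE /upd dfwithin muleA.
  rewrite (_ : \prod_(i | (i \notin s) && (i != v)) _ =
    \prod_(w | w \notin v :: s) dirac (x w) (B w)); last first.
    apply: eq_big => [w|w /andP[_ wv]]; first by rewrite in_cons negb_or andbC.
    by rewrite dfwithout// eq_sym.
  rewrite -muleA (muleC _ (\prod_(_ | _) _)) muleA -indicE.
  over.
rewrite ge0_integralZl//.
- by rewrite integral_indic// setIT big_cons muleC muleA.
- by apply/measurable_EFinP; exact: measurable_indic.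
- by rewrite mule_ge0// prode_ge0.
Qed.

Lemma prod_measure_box (S : {set V}) x (B : forall v, set (X v)) :
  (forall v, measurable (B v)) ->
  prod_measure S x [set y | forall v, B v (y v)] =
  \prod_(v in S) mu v (B v) * \prod_(v | v \notin S) dirac (x v) (B v).
Proof.
move=> mB; rewrite /prod_measure iterated_integral_box ?enum_uniq//.
congr (_ * _); first by rewrite big_enum.
by apply: eq_bigl => v; rewrite mem_enum.
Qed.

End ProductMeasure.

Section Factorization.
Context (R : realType) (V : finType) (d : V -> measure_display).
Context (X : forall v, measurableType (d v)).
Variable mu : forall v, {sigma_finite_measure set (X v) -> \bar R}.
Variables (A : {set V}) (a0 : config X).
Implicit Types (G : mixed_graph V) (f : config X -> R).

Definition depends_only_on (h : {set V}) (p : config X -> R) : Prop :=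
  forall x y : config X, (forall v, v \in h -> x v = y v) -> p x = p y.

Definition is_density (m : set (config X) -> \bar R) f : Prop :=
  [/\ measurable_fun setT f, forall x, 0 <= f x
    & (\int[m]_x (f x)%:E = 1)%E].

Section Component.
Variables (C : {set {set V}}) (T : {set V}) (psi : {set V} -> config X -> R).

Definition normalizer (x : config X) : \bar R :=
  (\int[prod_measure mu (T :\: A)%SET x]_y (\prod_(h in C) psi h y)%:E)%E.

(* Z^-1 is 0 when Z is 0 or +oo.  If a probability density equals almost
   everywhere a product of such factors, every Z is positive and finite almost
   surely under that density. *)
Definition conditional (x : config X) : R :=
  (fine (normalizer x))^-1 * \prod_(h in C) psi h x.

End Component.

(* a0 matters only through its coordinates in A.  The intervention puts the
   variables in A at a0, so densities are taken with respect to the product of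
   the mu v for v outside A and of the point masses at a0 v for v in A.  This
   makes sense also when mu v gives no mass to a0 v; when the singletons of the
   values a0 v have mu v-measure 1 (e.g. counting measure), a function vanishing
   off x_A = a0 is a density for this measure iff it is one for the product of
   all the mu v. *)
Definition intervention_measure := prod_measure mu (~: A)%SET a0.

(* psi is indexed by the chain component and by the clique.  As for all
   densities, equality is almost everywhere. *)
Definition factorizes G f : Prop :=
  [/\ is_density intervention_measure f,
      forall x : config X, (exists2 a, a \in A & x a <> a0 a) -> f x = 0
    & exists psi : {set V} -> {set V} -> config X -> R,
        (forall T h, T \in chain_components G -> h \in component_cliques G T ->
           [/\ measurable_fun setT (psi T h), forall x, 0 <= psi T h x
             & depends_only_on h (psi T h)]) /\
        {ae intervention_measure, forall x,
           (forall a, a \in A -> x a = a0 a) ->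
           f x = \prod_(T in chain_components G)
                   conditional (component_cliques G T) T (psi T) x}].

Definition same_factorization_decomposition G1 G2 : Prop :=
  forall f, factorizes G1 f <-> factorizes G2 f.

End Factorization.

(* Main.v *)
Require Import Defs.
From mathcomp Require Import all_boot all_order all_algebra.
From mathcomp Require Import all_classical all_reals all_analysis.
From mathcomp Require Import measurable_realfun.

(* Both factorizations are compared with one over the chain components S of
   H = G1 \ A = G2 \ A, with factors k_S = Psi_S / int Psi_S dmu_S.  At x_A = a0,
   a chain component T of G splits: a clique of the moral graph of
   G_(T u pa(T)) meets T \ A in at most one component S of H, so the factor of T
   is prod_(S <= T) k_S, except that the cliques missing T \ A contribute a
   constant c_T that cancels when c_T <> 0 and makes the factor 0 when c_T = 0.
   Hence a density f that factorizes according to G is at most prod_S k_S.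
   Integrating out terminal components one at a time, prod_S k_S has mass at
   most 1, and f has mass 1, so f = prod_S k_S almost everywhere.  Conversely,
   every set occurring in Psi_S extends to a maximal clique of the moral graph
   of G_(T u pa(T)), for any G with G \ A = H. *)

Set Implicit Arguments.
Unset Strict Implicit.
Unset Printing Implicit Defensive.

Import Order.TTheory GRing.Theory Num.Theory.
Import numFieldNormedType.Exports.

Local Open Scope classical_set_scope.
Local Open Scope ring_scope.

(** * Iterated integrals *)

Section IteratedIntegral.
Context (R : realType) (V : finType) (d : V -> measure_display).
Context (X : forall v, measurableType (d v)).
Variable mu : forall v, {sigma_finite_measure set (X v) -> \bar R}.
Local Open Scope ereal_scope.
Implicit Types (s : seq V) (x y : config X) (F : config X -> \bar R).
Local Notation iter := (iterated_integral mu).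

Definition determined_by (U : Type) (D : {set V}) (F : config X -> U) :=
  forall x y, (forall v, v \in D -> x v = y v) -> F x = F y.

Lemma updE x (v : V) (t : X v) : upd x t v = t.
Proof. exact: dfwithin. Qed.

Lemma upd_neq x (v w : V) (t : X v) : w != v -> upd x t w = x w.
Proof. by move=> wv; rewrite /upd dfwithout// eq_sym. Qed.

Lemma upd_comm x (v w : V) (t : X v) (u : X w) : v != w ->
  upd (upd x t) u = upd (upd x u) t.
Proof.
move=> vw; apply: functional_extensionality_dep => z.
have [->|zw] := eqVneq z w; first by rewrite updE upd_neq 1?eq_sym// updE.
have [->|zv] := eqVneq z v; first by rewrite updE upd_neq// updE.
by rewrite !upd_neq.
Qed.

(** Integration over [s] started at [x] only visits configurations that agree with [x] off [s]. The
    constraint [x_A = a0] and normalizers constant along [s] enter later integrals in this way. *)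
Lemma eq_iterated_integral s F F' x :
  (forall y, (forall v, v \notin s -> y v = x v) -> F y = F' y) ->
  iter s F x = iter s F' x.
Proof.
elim: s x => [|v s IHs] x FF' /=; first exact: FF'.
apply: eq_integral => t _; apply: IHs => y yx; apply: FF' => w.
by rewrite in_cons negb_or => /andP[wv ws]; rewrite yx// upd_neq.
Qed.

Lemma iterated_integral_cat s s' F x :
  iter (s ++ s') F x = iter s (iter s' F) x.
Proof. by elim: s x => [//|v s IHs] x /=; apply: eq_integral. Qed.

Lemma iterated_integral_determined s D F : determined_by D F ->
  forall x y, (forall v, v \in D -> v \notin s -> x v = y v) ->
  iter s F x = iter s F y.
Proof.
move=> DF; elim: s => [|v s IHs] x y xy /=.
  by apply: DF => v vD; exact: xy.
apply: eq_integral => t _; apply: IHs => w wD ws.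
have [->|wv] := eqVneq w v; first by rewrite !updE.
by rewrite !upd_neq// xy// in_cons negb_or wv.
Qed.

Lemma le_iterated_integral s F F' :
  (forall x, 0 <= F x) -> measurable_fun [set: config X] F ->
  (forall x, 0 <= F' x) -> measurable_fun [set: config X] F' ->
  (forall x, F x <= F' x) -> forall x, iter s F x <= iter s F' x.
Proof.
move=> F0 mF F'0 mF' FF'; elim: s => [//|v s IHs] x /=.
apply: ge0_le_integral => //.
- by move=> t _; exact: iterated_integral_ge0.
- exact: measurable_iterated_integral_upd.
- exact: measurable_iterated_integral_upd.
Qed.

Lemma iterated_integralZl s F k : 0 <= k ->
  (forall x, 0 <= F x) -> measurable_fun [set: config X] F ->
  forall x, iter s (fun y => k * F y) x = k * iter s F x.
Proof.
move=> k0 F0 mF; elim: s => [//|v s IHs] x /=.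
under eq_integral do rewrite IHs.
rewrite ge0_integralZl//; first exact: measurable_iterated_integral_upd.
by move=> t _; exact: iterated_integral_ge0.
Qed.

Lemma iterated_integral_swap s (v w : V) F : v != w ->
  (forall x, 0 <= F x) -> measurable_fun [set: config X] F ->
  forall x, iter (v :: w :: s) F x = iter (w :: v :: s) F x.
Proof.
move=> vw F0 mF x /=.
rewrite (@fubini_tonelli _ _ _ _ _ (mu v) (mu w)
  (fun p => iter s F (upd (upd x p.1) p.2))).
- apply: eq_integral => t _; apply: eq_integral => u _ /=.
  by rewrite upd_comm.
(* The double update is a composition of two measurable updates; [g] performs the first and carries
   the second value along. *)
- pose g (p : X v * X w) : config X * X w := (upd x p.1, p.2).
  have mg : measurable_fun setT g.
    apply: measurable_fun_pair; last exact: measurable_snd.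
    have mx : measurable_fun setT (fun p : X v * X w => (x, p.1)).
      exact: measurable_fun_pair (measurable_cst _) measurable_fst.
    exact: (measurableT_comp (@measurable_upd _ _ X v) mx).
  exact: (measurableT_comp (measurable_iterated_integral mu s F0 mF)
    (measurableT_comp (@measurable_upd _ _ X w) mg)).
- by move=> p; exact: iterated_integral_ge0.
Qed.

Lemma perm_iterated_integral s s' F : uniq s -> perm_eq s s' ->
  (forall x, 0 <= F x) -> measurable_fun [set: config X] F ->
  forall x, iter s F x = iter s' F x.
Proof.
move=> us ss' F0 mF.
elim: s s' us ss' => [|v s IHs] s' /= us ss' x.
  by move: ss'; rewrite perm_sym => /perm_nilP ->.
case/andP: us => vs us.
have vs' : v \in s' by rewrite -(perm_mem ss') mem_head.
have us' : uniq s' by rewrite -(perm_uniq ss') /= vs.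
move: ss' us'; case/splitPr: vs' => s1 s2.
rewrite perm_sym (perm_catCA s1 [:: v] s2) perm_cons perm_sym => ss' us'.
(* By induction the tail may be taken to be [s1 ++ s2]; it remains to move [v] past [s1] by adjacent
   swaps. *)
rewrite (eq_integral (fun t => iter (s1 ++ s2) F (upd x t))); last first.
  by move=> t _; exact: IHs.
rewrite -[LHS]/(iter (v :: s1 ++ s2) F x).
have {us'} : v \notin s1 by move: us'; rewrite cat_uniq /= => /and3P[_ /norP[]].
elim: s1 x {IHs ss'} => [//|w s1 IHs1] x.
rewrite in_cons negb_or => /andP[vw vs1].
rewrite cat_cons iterated_integral_swap//=.
by apply: eq_integral => t _; rewrite -IHs1.
Qed.

(* The blocks [B i] need not be contiguous in [s]. *)
Lemma iterated_integral_prod (I : finType) (P : pred I) (B D : I -> {set V})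
    (F : I -> config X -> \bar R) s : uniq s ->
  (forall v, v \in s -> exists2 i, P i & v \in B i) ->
  (forall v i j, P i -> P j -> v \in B i -> v \in B j -> i = j) ->
  (forall i x, P i -> 0 <= F i x) ->
  (forall i, P i -> measurable_fun [set: config X] (F i)) ->
  (forall i, P i -> determined_by (D i) (F i)) ->
  (forall i v, P i -> v \in s -> v \in D i -> v \in B i) ->
  forall x, iter s (fun y => \prod_(i | P i) F i y) x =
    \prod_(i | P i) iter [seq v <- s | v \in B i] (F i) x.
Proof.
move=> us sB Bdisj F0 mF DF DB; elim: s us sB DB => [|v s IHs] /= us sB DB x.
  by [].
case/andP: us => vs us.
have [i Pi vBi] := sB v (mem_head _ _).
under eq_integral => t _.
  rewrite IHs//; first last.
  - by move=> j w Pj ws; apply: DB => //; rewrite in_cons ws orbT.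
  - by move=> w ws; apply: sB; rewrite in_cons ws orbT.
  rewrite (bigD1 i)//= muleC.
  (* [v] lies in the block of [i] alone, so the other factors do not see the update at [v] and leave
     the integral. *)
  rewrite (eq_bigr (fun j => iter [seq w <- s | w \in B j] (F j) x)); last first.
    move=> j /andP[Pj ji]; apply: iterated_integral_determined (DF _ Pj) _ _ _.
    move=> w wDj _; have [wv|wv] := eqVneq w v; last by rewrite upd_neq.
    subst w; case/eqP: ji; apply: (Bdisj v) => //.
    by apply: DB => //; rewrite mem_head.
  over.
rewrite ge0_integralZl//; first last.
- by apply: prode_ge0 => j /andP[Pj _]; apply: iterated_integral_ge0 => z; exact: F0.
- by move=> t _; apply: iterated_integral_ge0 => z; exact: F0.
- by apply: measurable_iterated_integral_upd; [move=> z; exact: F0|exact: mF].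
rewrite [RHS](bigD1 i)//= vBi muleC; congr (_ * _).
apply: eq_bigr => j /andP[Pj ji]; case: ifPn => // vBj.
by case/eqP: ji; exact: (Bdisj v).
Qed.

Lemma iterated_integral_fsum s (I : choiceType) (F : I -> config X -> \bar R)
    (K : set I) : finite_set K ->
  (forall i x, 0 <= F i x) ->
  (forall i, measurable_fun [set: config X] (F i)) ->
  forall x, iter s (fun y => \sum_(i \in K) F i y) x =
            \sum_(i \in K) iter s (F i) x.
Proof.
move=> finK F0 mF; elim: s => [//|v s IHs] x /=.
under eq_integral do rewrite IHs.
rewrite ge0_integral_fsum//.
- by move=> i; exact: measurable_iterated_integral_upd.
- by move=> i t _; exact: iterated_integral_ge0.
Qed.

Lemma iterated_integral_monotone_convergence s (F : nat -> config X -> \bar R) :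
  (forall n x, 0 <= F n x) ->
  (forall n, measurable_fun [set: config X] (F n)) ->
  (forall x, {homo F^~ x : m n / (m <= n)%N >-> m <= n}) ->
  forall x, iter s (fun y => limn (F^~ y)) x = limn (fun n => iter s (F n) x).
Proof.
move=> F0 mF ndF; elim: s => [//|v s IHs] x /=.
under eq_integral do rewrite IHs.
rewrite monotone_convergence//.
- by move=> n; exact: measurable_iterated_integral_upd.
- by move=> n t _; exact: iterated_integral_ge0.
- move=> t _ m n mn; apply: le_iterated_integral => // z.
  exact: ndF.
Qed.

(** * Integration against [prod_measure] *)

Import HBNNSimple.

Let integral_prod_measure_nnsfun (S : {set V}) x
    (f : {nnsfun (config X) >-> R}) :
  \int[prod_measure mu S x]_y (f y)%:E = iter (enum S) (fun y => (f y)%:E) x.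
Proof.
have fE y : (f y)%:E = \sum_(r \in range f) (r * \1_(f @^-1` [set r]) y)%:E.
  by rewrite fimfunE -fsumEFin.
have f0 r y : 0 <= (r * \1_(f @^-1` [set r]) y)%:E.
  by rewrite EFinM nnfun_muleindic_ge0.
have mf r : measurable_fun setT (fun y => (r * \1_(f @^-1` [set r]) y)%:E).
  by apply/measurable_EFinP/measurableT_comp.
under eq_integral do rewrite fE.
rewrite ge0_integral_fsum//.
under [in RHS]eq_iterated_integral do rewrite fE.
rewrite iterated_integral_fsum//.
apply: eq_fsbigr => r; rewrite inE => -[y _ <-].
rewrite (_ : (fun z => _) =
  (fun z => (f y)%:E * (\1_(f @^-1` [set f y]) z)%:E)); last first.
  by apply/funext => z; rewrite EFinM.
rewrite iterated_integralZl ?lee_fin//; last exact/measurable_EFinP.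
rewrite ge0_integralZl ?lee_fin//; last exact/measurable_EFinP.
by rewrite integral_indic ?setIT.
Qed.

(** On indicators this is the definition of [prod_measure]; linearity gives simple functions, and
    monotone convergence, passed through each of the finitely many integrals, gives the rest. *)
Lemma integral_prod_measure (S : {set V}) F x : (forall y, 0 <= F y) ->
  measurable_fun [set: config X] F ->
  \int[prod_measure mu S x]_y F y = iter (enum S) F x.
Proof.
move=> F0 mF; pose f_ := nnsfun_approx measurableT mF.
have FE : F = fun y => limn (fun n => (f_ n y)%:E).
  by apply/funext => y; apply/esym/cvg_lim => //; exact: cvg_nnsfun_approx.
have ndf y : {homo (fun n => (f_ n y)%:E) : m n / (m <= n)%N >-> m <= n}.
  by move=> m n mn; rewrite lee_fin; exact/lefP/nd_nnsfun_approx.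
have mf n : measurable_fun setT (fun y => (f_ n y)%:E) by exact/measurable_EFinP.
rewrite [in LHS]FE [in RHS]FE monotone_convergence//; last first.
  by move=> n y _; rewrite lee_fin.
rewrite (@iterated_integral_monotone_convergence _ (fun n y => (f_ n y)%:E))//.
  by under eq_fun do rewrite integral_prod_measure_nnsfun.
by move=> n y; rewrite lee_fin.
Qed.

End IteratedIntegral.

(** * Chain components after an intervention *)

Section ChainGraphs.
Context (V : finType).
Implicit Types (G K : mixed_graph V) (S T h A : {set V}) (u v w : V).
Local Open Scope set_scope.

Section Components.
Variables (K : mixed_graph V).
Hypothesis symK : symmetric (und_rel K).

Let connect_und_equiv :
  {in verts K & &, equivalence_rel (connect (und_rel K))}.
Proof.
move=> x y z _ _ _; split=> [|xy]; first exact: connect0.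
exact: (same_connect (sym_connect_sym symK) xy z).
Qed.

Let partition_components : finset.partition (chain_components K) (verts K).
Proof. exact: equivalence_partitionP. Qed.

Lemma component_sub T : T \in chain_components K -> T \subset verts K.
Proof.
by rewrite -(cover_partition partition_components) => TK; exact: finset.bigcup_sup.
Qed.

Lemma mem_component T u w : T \in chain_components K -> u \in T ->
  (w \in T) = (w \in verts K) && connect (und_rel K) u w.
Proof.
move=> TK uT; have uK := fintype.subsetP (component_sub TK) _ uT.
have [wK|wK] /= := boolP (w \in verts K); last first.
  by apply: contraNF wK; exact/fintype.subsetP/component_sub.
rewrite -(pblock_equivalence_partition connect_und_equiv)//.
rewrite -/(chain_components K) (def_pblock _ TK)//.
by case/and3P: partition_components.
Qed.

Lemma component_connect T u w : T \in chain_components K -> u \in T ->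
  w \in T -> connect (und_rel K) u w.
Proof. by move=> TK uT; rewrite (mem_component _ TK uT) => /andP[]. Qed.

Lemma component_ex u : u \in verts K ->
  exists2 T, T \in chain_components K & u \in T.
Proof.
by rewrite -(cover_partition partition_components) => /bigcupP[T]; exists T.
Qed.

Lemma component_inj T T' u : T \in chain_components K ->
  T' \in chain_components K -> u \in T -> u \in T' -> T = T'.
Proof.
move=> TK T'K uT uT'; apply/setP => w.
by rewrite (mem_component _ TK uT) (mem_component _ T'K uT').
Qed.

Lemma component_neq0 T : T \in chain_components K -> exists u, u \in T.
Proof.
move=> TK; apply/set0Pn; apply: contraTneq TK => ->.
by case/and3P: partition_components.
Qed.

Lemma component_und T u w : T \in chain_components K -> w \in verts K ->
  u \in T -> (u, w) \in und K -> w \in T.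
Proof.
by move=> TK wK uT uw; rewrite (mem_component _ TK uT) wK connect1.
Qed.

Lemma cover_components : finset.cover (chain_components K) = verts K.
Proof. exact: cover_partition partition_components. Qed.

End Components.

Section ChainGraph.
Variables (G : mixed_graph V) (A : {set V}).
Hypotheses (chainG : chain_graph G) (vertsG : verts G = [set: V]).
Local Notation H := (delete G A).

Let symG : symmetric (und_rel G). Proof. by case: chainG. Qed.

Lemma und_sym u w : ((u, w) \in und G) = ((w, u) \in und G).
Proof. exact: symG. Qed.

Lemma und_connect_semi u w :
  connect (und_rel G) u w -> connect (semi_rel G) u w.
Proof.
by apply: connect_sub => x y xy; apply: connect1; apply/orP; left.
Qed.

(** A path from [w] back to [u], made free of repetitions, closes with [u -> w] into a partially
    directed cycle. *)
Lemma dir_no_return u w : (u, w) \in dir G -> ~~ connect (semi_rel G) w u.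
Proof.
move=> uw; apply/negP => /connectP[p wp uE].
have [_ _ _ nocyc] := chainG.
move: uE; case/shortenP: wp => c wc uc _ uE.
have uc' : u \in w :: c by rewrite uE mem_last.
have cyc : cycle (semi_rel G) (w :: c).
  by rewrite /= rcons_path wc -uE /=; apply/orP; right.
move/negP: (nocyc _ uc cyc _ uc'); apply.
(* [u] is the last vertex of the list, so its cyclic successor is the head [w]. *)
have {2}-> : u = prev (w :: c) w.
  by rewrite prev_nth mem_head memNindex ?uE ?nth_last//; case/andP: uc.
by rewrite next_prev.
Qed.

Lemma component_dir T u w : T \in chain_components G -> u \in T -> w \in T ->
  (u, w) \notin dir G.
Proof.
move=> TG uT wT; apply: contraTN isT => /dir_no_return/negP; case.
exact/und_connect_semi/(component_connect symG TG).
Qed.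

Lemma component_no_return T u w v : T \in chain_components G ->
  u \in T -> w \in T -> connect (semi_rel G) w v -> (v, u) \notin dir G.
Proof.
move=> TG uT wT wv; apply/negP => /dir_no_return/negP; apply.
apply: connect_trans wv.
exact/und_connect_semi/(component_connect symG TG).
Qed.

Lemma parentsP T v : reflect (v \notin T /\ exists2 t, t \in T & (v, t) \in dir G)
  (v \in parents G T).
Proof.
rewrite !inE; apply: (iffP andP) => -[vT].
  by move=> /bigcupP[t tT]; rewrite inE => vt; split => //; exists t.
by case=> t tT vt; split => //; apply/bigcupP; exists t => //; rewrite inE.
Qed.

Lemma verts_delete : verts H = ~: A.
Proof. by rewrite /= vertsG !finset.setTI finset.setTD. Qed.

Lemma und_delete u w :
  ((u, w) \in und H) = [&& (u, w) \in und G, u \notin A & w \notin A].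
Proof. by rewrite !inE vertsG !inE !andbT. Qed.

Lemma dir_delete u w :
  ((u, w) \in dir H) = [&& (u, w) \in dir G, u \notin A & w \notin A].
Proof. by rewrite !inE vertsG !inE !andbT. Qed.

Lemma sym_delete : symmetric (und_rel H).
Proof.
move=> u w; rewrite -[LHS]/((u, w) \in und H) -[RHS]/((w, u) \in und H).
by rewrite !und_delete; congr (_ && _); [exact: symG|rewrite andbC].
Qed.

Lemma component_deleteN S v : S \in chain_components H -> v \in S -> v \notin A.
Proof.
move=> /(component_sub sym_delete)/fintype.subsetP + vS => /(_ _ vS).
by rewrite verts_delete inE.
Qed.

(** Deletion only removes edges, so the components of [H] refine those of [G]. *)
Lemma component_delete_sub S T w : S \in chain_components H ->
  T \in chain_components G -> w \in S -> w \in T -> S \subset T.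
Proof.
move=> SH TG wS wT; apply/fintype.subsetP => u uS.
rewrite (mem_component symG _ TG wT) vertsG inE /=.
apply: connect_sub (component_connect sym_delete SH wS uS) => x y.
rewrite -[und_rel H x y]/((x, y) \in und H) und_delete => /and3P[xy _ _].
exact: connect1.
Qed.

Lemma component_delete_ex S : S \in chain_components H ->
  exists2 T, T \in chain_components G & S \subset T.
Proof.
move=> SH; have [w wS] := component_neq0 sym_delete SH.
have [T TG wT] : exists2 T, T \in chain_components G & w \in T.
  by apply: component_ex => //; rewrite vertsG.
by exists T => //; exact: component_delete_sub wS wT.
Qed.

Section Closure.
Variables (T : {set V}).
Hypothesis TG : T \in chain_components G.
Local Notation K := (Defs.induced G (T :|: parents G T)).

Lemma dir_into_component u t : t \in T -> (u, t) \in dir G -> u \in parents G T.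
Proof.
move=> tT ut; apply/parentsP; split; last by exists t.
by apply: contraTN ut => uT; exact: component_dir TG uT tT.
Qed.

(** An arrow from [T] to one of its parents would be followed by an arrow back into [T], closing a
    partially directed cycle. *)
Lemma dir_from_component t v : t \in T -> v \in T :|: parents G T ->
  (t, v) \notin dir G.
Proof.
move=> tT; rewrite finset.in_setU => /orP[vT|/parentsP[_ [t' t'T vt']]].
  exact: component_dir TG tT vT.
apply/negP => tv.
have tv' : connect (semi_rel G) t v by apply: connect1; apply/orP; right.
by have := component_no_return TG t'T tT tv'; rewrite vt'.
Qed.

Let vertsK : verts K = T :|: parents G T.
Proof. by rewrite /= vertsG finset.setTI. Qed.

Let symK : symmetric (und_rel K).
Proof.
move=> u w; rewrite -[LHS]/((u, w) \in und K) -[RHS]/((w, u) \in und K) !inE /=.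
by congr (_ && _); [exact: symG|rewrite andbC].
Qed.

(** A vertex of [T] has no outgoing arrow in [K], and an undirected neighbour of [T'] in [K] belongs
    to [T']. Hence moralization adds no edge at a vertex of [T]. *)
Lemma notin_boundary_closure T' t : T' \in chain_components K -> t \in T ->
  t \notin boundary K T'.
Proof.
move=> T'K tT; apply/negP; rewrite inE => /andP[tT' /bigcupP[v vT']].
have := fintype.subsetP (component_sub symK T'K) _ vT'; rewrite vertsK => vTp.
rewrite !inE /= => /orP[]/andP[tv /andP[tTp _]].
  by move/negP: (dir_from_component tT vTp); apply.
move/negP: tT'; apply.
apply: (component_und symK T'K _ vT'); first by rewrite vertsK finset.in_setU tT.
by rewrite inE /= und_sym tv vTp finset.in_setU tT.
Qed.

Lemma clique_und h u w : h \in component_cliques G T -> u \in h -> w \in h ->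
  u \in T -> w \in T -> u != w -> (u, w) \in und G.
Proof.
rewrite inE => /maxsetp/andP[_ /'forall_in_'forall_in_implyP hK].
move=> uh wh uT wT /(hK _ uh _ wh)/andP[_ /orP[]]; last first.
  case/existsP => T' /and3P[T'K uT' _].
  by have := notin_boundary_closure T'K uT; rewrite uT'.
have in_und x y : x \in T -> y \in T -> semi_rel K x y -> (x, y) \in und G.
  move=> xT yT /orP[]; rewrite inE /= => /andP[] // xy _.
  by have := component_dir TG xT yT; rewrite xy.
move=> /orP[]; first exact: in_und.
by move=> /(in_und _ _ wT uT); rewrite und_sym.
Qed.

(** The two vertices are adjacent in [G], since no moral edge ends in [T]. An undirected edge would
    put [u] into [T], and [dir_from_component] excludes the arrow [w -> u]. *)
Lemma clique_dir h u w : h \in component_cliques G T -> u \in h -> w \in h ->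
  u \notin T -> w \in T -> (u, w) \in dir G.
Proof.
rewrite inE => /maxsetp/andP[hK0 /'forall_in_'forall_in_implyP hK].
move=> uh wh uT wT.
have uTp : u \in T :|: parents G T.
  by have := fintype.subsetP hK0 _ uh; rewrite vertsK.
have uw : u != w by apply: contraNneq uT => ->.
have uN : (u, w) \notin und G.
  apply: contraNN uT => uw'; apply: (component_und symG TG _ wT).
    by rewrite vertsG.
  by rewrite und_sym.
case/andP: (hK _ uh _ wh uw) => _ /orP[/orP[]/orP[]|]; rewrite ?inE /=.
- by case/andP; rewrite (negPf uN).
- by case/andP.
- by case/andP; rewrite und_sym (negPf uN).
- by case/andP; rewrite (negPf (dir_from_component wT uTp)).
- case/existsP => T' /and3P[T'K _ wT'].
  by have := notin_boundary_closure T'K wT; rewrite wT'.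
Qed.

(** Undirected paths from a vertex of [T] never leave [T], so they survive in [K].
    [split_clique_extend] needs this in order to marry the parents of [T]. *)
Lemma component_closure : T \in chain_components K.
Proof.
have [t tT] := component_neq0 symG TG.
have tK : t \in verts K by rewrite vertsK finset.in_setU tT.
have [T' T'K tT'] := component_ex symK tK.
suff TT' : T = T' by move: T'K; rewrite -TT'.
apply/eqP; rewrite finset.eqEsubset; apply/andP; split; apply/fintype.subsetP => w; last first.
  rewrite (mem_component symK _ T'K tT') (mem_component symG _ TG tT).
  case/andP=> _ tw; rewrite vertsG inE /=.
  apply: connect_sub tw => x y.
  rewrite -[und_rel K x y]/((x, y) \in und K) inE => /andP[xy _].
  exact: connect1.
move=> wT; have /connectP[p tp ->] := component_connect symG TG tT wT.
elim: p t tp tT tT' {tK} => [//|v p IHp] t /= /andP[tv vp] tT tT'.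
have vT : v \in T by apply: (component_und symG TG _ tT tv); rewrite vertsG.
apply: IHp => //; apply: (component_und symK T'K _ tT').
  by rewrite vertsK finset.in_setU vT.
by rewrite inE /= -[(t, v) \in und G]/(und_rel G t v) tv !inE tT vT.
Qed.

End Closure.

(* For a chain component [S] of [K]: the cliques meeting [S] of the moral graph
   of [K] restricted to [S :|: parents K S]. *)
Definition split_clique K S h :=
  (exists2 w, w \in h & w \in S) /\
  forall u w, u \in h -> w \in h -> w \in S -> u != w ->
    if u \in S then (u, w) \in und K else (u, w) \in dir K.

(** Clique members in [T] off [A] are joined to those in [S] by undirected edges that survive the
    deletion, so they lie in [S]; members outside [T] are parents of those in [S]. *)
Lemma split_cliqueD S T h w : S \in chain_components H ->
  T \in chain_components G -> h \in component_cliques G T ->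
  w \in h -> w \in S -> w \in T -> split_clique H S (h :\: A).
Proof.
move=> SH TG hC wh wS wT.
have ST := fintype.subsetP (component_delete_sub SH TG wS wT).
split; first by exists w => //; rewrite inE wh (component_deleteN SH wS).
move=> u v; rewrite !finset.in_setD => /andP[uA uh] /andP[vA vh] vS uv.
have vT := ST _ vS; have [uT|uT] := boolP (u \in T).
  have uvH : (u, v) \in und H.
    by rewrite und_delete uA vA (clique_und TG hC).
  suff -> : u \in S by [].
  apply: (component_und sym_delete SH _ vS); first by rewrite verts_delete inE.
  by rewrite -[_ \in _]/(und_rel H v u) sym_delete.
rewrite (negPf (contraNN (ST u) uT)) dir_delete uA vA (clique_dir TG hC)//.
Qed.

(** Two vertices of [h] in [T] off [A] are joined by an undirected edge, which survives in [H]. *)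
Lemma clique_meets_one S S' T h w w' : S \in chain_components H ->
  S' \in chain_components H ->
  T \in chain_components G -> h \in component_cliques G T ->
  w \in h -> w \in S -> w \in T -> w' \in h -> w' \in S' -> w' \in T -> S = S'.
Proof.
move=> SH S'H TG hC wh wS wT w'h w'S' w'T.
apply: (component_inj sym_delete SH S'H wS).
have [->//|ww'] := eqVneq w w'.
have wA := component_deleteN SH wS; have w'A := component_deleteN S'H w'S'.
apply: (component_und sym_delete S'H _ w'S'); first by rewrite verts_delete inE.
by rewrite und_delete wA w'A (clique_und TG hC)// eq_sym.
Qed.

(** Pairs of [k] that meet [S] are adjacent through edges of [H], hence of [G]; the remaining pairs
    are parents of [T] and are married in the moral graph. So [k] is a clique there and extends to a
    maximal one. *)
Lemma split_clique_extend S T k : S \in chain_components H ->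
  T \in chain_components G -> S \subset T -> split_clique H S k ->
  exists2 h, h \in component_cliques G T & k \subset h.
Proof.
move=> SH TG /fintype.subsetP ST [[t tk tS] kS].
have kp u : u \in k -> u \notin S -> u \in parents G T.
  move=> uk uS; have ut : u != t by apply: contraNneq uS => ->.
  have := kS u t uk tk tS ut; rewrite (negPf uS) dir_delete => /and3P[ut' _ _].
  by apply: dir_into_component ut' => //; exact: ST.
have kTp : k \subset T :|: parents G T.
  apply/fintype.subsetP => u uk; rewrite finset.in_setU; have [/ST->//|uS] := boolP (u \in S).
  by rewrite kp ?orbT.
set K := Defs.induced G (T :|: parents G T).
have edge u w : u \in k -> w \in k -> w \in S -> u != w -> semi_rel K u w.
  move=> uk wk wS uw; have := kS u w uk wk wS uw.
  rewrite und_delete dir_delete.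
  rewrite -[semi_rel K u w]/(((u, w) \in und K) || ((u, w) \in dir K)) !inE /=.
  have := fintype.subsetP kTp _ uk; have := fintype.subsetP kTp _ wk; rewrite !inE => -> ->.
  by case: ifP => _ /and3P[-> _ _]; rewrite ?orbT.
suff /maxset_exists[h hmax kh] : moral_clique K k by exists h => //; rewrite inE.
apply/andP; split; first by rewrite /= vertsG finset.setTI.
apply/'forall_in_'forall_in_implyP => u uk w wk uw.
apply/andP; split => //; have [wS|wS] := boolP (w \in S).
  by apply/orP; left; apply/orP; left; exact: edge.
have [uS|uS] := boolP (u \in S).
  by apply/orP; left; apply/orP; right; apply: edge; rewrite // eq_sym.
apply/orP; right; apply/existsP; exists T; rewrite component_closure//=.
have bd v : v \in parents G T -> v \in boundary K T.
  move=> vp; case/parentsP: (vp) => vT [t' t'T vt'].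
  rewrite inE vT; apply/bigcupP; exists t' => //.
  rewrite finset.in_setU [v \in pa _ _]inE [_ \in dir K]inE /=.
  by rewrite vt' !finset.in_setU vp t'T orbT.
by rewrite !bd// kp.
Qed.

(** [S] is the component of a vertex [v] of the union of [Q] that reaches the fewest vertices in
    [G]. If some [z] in [S] had an arrow to [w] in another member, then [v] would reach all that [w]
    reaches; by minimality [w] would reach [v], hence [z], against [dir_no_return]. *)
Lemma terminal_component (Q : {set {set V}}) :
  Q \subset chain_components H -> Q != finset.set0 ->
  exists2 S, S \in Q & forall S', S' \in Q -> S' != S ->
    {in S' :|: parents H S', forall z, z \notin S}.
Proof.
move=> /fintype.subsetP QH /set0Pn[S0 S0Q].
have [v0 v0S0] := component_neq0 sym_delete (QH _ S0Q).
pose reach v := [set w | connect (semi_rel G) v w].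
have v0Q : v0 \in finset.cover Q by apply/bigcupP; exists S0.
case: (arg_minnP (fun v => #|reach v|) v0Q) => v /bigcupP[S SQ vS] vmin.
exists S => // S' S'Q S'S z.
rewrite finset.in_setU => /orP[zS'|].
  by apply: contraNN S'S => zS; apply/eqP/(component_inj sym_delete (QH _ S'Q) (QH _ SQ) zS').
rewrite inE => /andP[_ /bigcupP[w wS']]; rewrite inE dir_delete => /and3P[zw _ _].
apply/negP => zS; have [T TG ST] := component_delete_ex (QH _ SQ).
have vz : connect (semi_rel G) v z.
  apply/und_connect_semi/(component_connect symG TG); exact: (fintype.subsetP ST).
have vw : connect (semi_rel G) v w.
  by apply: connect_trans vz (connect1 _); apply/orP; right.
have sub : reach w \subset reach v.
  by apply/fintype.subsetP => x; rewrite !inE; exact: connect_trans.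
have /eqP rE : reach w == reach v.
  by rewrite eqEcard sub vmin//; apply/bigcupP; exists S'.
have : v \in reach w by rewrite rE inE.
rewrite inE => wv; move/negP: (dir_no_return zw); apply.
exact: connect_trans wv vz.
Qed.

End ChainGraph.
End ChainGraphs.

(** * Factorization over the components left by the intervention *)

Lemma measurable_funVr (R : realType) :
  measurable_fun [set: R] (fun r : R => r^-1).
Proof.
rewrite -(setvU [set 0]).
apply/measurable_funU => //; first exact: measurableC.
split; last exact: measurable_fun_set1.
apply: open_continuous_measurable_fun; first exact/closed_openC/closed_eq.
by move=> r; rewrite inE /= => r0; apply: inv_continuous; apply/eqP.
Qed.

(** [fine] sends [+oo] to 0, so both sides vanish when a factor is infinite. The convention for
    infinite normalizers is thus compatible with products. *)
Lemma fineM_ge0 (R : realDomainType) (x y : \bar R) :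
  (0 <= x)%E -> (0 <= y)%E -> fine (x * y) = fine x * fine y.
Proof.
case: x => [r| |] //; case: y => [r'| |] //; rewrite ?lee_fin => r0 r'0.
- by have [->|r00] := eqVneq r 0; rewrite ?mul0e ?mul0r//= gt0_muley ?mulr0// lte_fin lt0r r00.
- by have [->|r00] := eqVneq r' 0; rewrite ?mule0 ?mulr0//= gt0_mulye ?mul0r// lte_fin lt0r r00.
- by rewrite mulyy mul0r.
Qed.

Lemma fine_prod_ge0 (R : realDomainType) (I : finType) (P : pred I)
    (F : I -> \bar R) : (forall i, P i -> 0 <= F i)%E ->
  fine (\prod_(i | P i) F i)%E = \prod_(i | P i) fine (F i).
Proof.
move=> F0; have [] // : (0 <= \prod_(i | P i) F i)%E /\
    fine (\prod_(i | P i) F i)%E = \prod_(i | P i) fine (F i).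
apply: (big_ind2 (fun x y => (0 <= x)%E /\ fine x = y)).
- by split.
- by move=> x _ y _ [x0 <-] [y0 <-]; rewrite fineM_ge0// mule_ge0.
- by move=> i Pi; split => //; exact: F0.
Qed.

(** [k], the minimum of [g] and [h], equals [g] almost everywhere, and [h - k] is nonnegative
    everywhere; as the integral of [g] is finite, it can be subtracted, which leaves [h - k] with
    integral 0. *)
Lemma ae_eq_of_le (d : measure_display) (T : measurableType d) (R : realType)
    (m : {measure set T -> \bar R}) (g h : T -> R) :
  measurable_fun setT g -> (forall x, 0 <= g x) ->
  measurable_fun setT h -> (forall x, 0 <= h x) ->
  (\int[m]_x (g x)%:E < +oo)%E ->
  (\int[m]_x (h x)%:E <= \int[m]_x (g x)%:E)%E ->
  {ae m, forall x, g x <= h x} -> {ae m, forall x, g x = h x}.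
Proof.
move=> mg g0 mh h0 goo hg gh; pose k x := Num.min (g x) (h x).
have mk : measurable_fun setT k by exact: measurable_minr.
have k0 x : 0 <= k x by rewrite le_min g0 h0.
have gk : {ae m, forall x, g x = k x}.
  by apply: filterS gh => x gx; rewrite /k min_l.
have intk : (\int[m]_x (k x)%:E = \int[m]_x (g x)%:E)%E.
  apply: ge0_ae_eq_integral => //; [exact/measurable_EFinP|exact/measurable_EFinP| | |].
  - by move=> x _; rewrite lee_fin.
  - by move=> x _; rewrite lee_fin.
  - by apply: filterS gk => x -> _.
have hk0 x : 0 <= h x - k x by rewrite subr_ge0 /k ge_min lexx orbT.
have mhk : measurable_fun setT (fun x => (h x - k x)%:E).
  by apply/measurable_EFinP; exact: measurable_funB.
have : (\int[m]_x (h x - k x)%:E + \int[m]_x (k x)%:E = \int[m]_x (h x)%:E)%E.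
  rewrite -ge0_integralD//.
  - by apply: eq_integral => x _; rewrite -EFinD subrK.
  - by move=> x _; rewrite lee_fin.
  - by move=> x _; rewrite lee_fin.
  - exact/measurable_EFinP.
rewrite intk => hE; move: hg; rewrite -hE.
have gfin : (\int[m]_x (g x)%:E \is a fin_num)%E.
  by rewrite ge0_fin_numE// integral_ge0// => x _; rewrite lee_fin.
rewrite -[leRHS]add0e leeD2rE// => hk_le0.
have hk : (\int[m]_x `|(h x - k x)%:E| = 0)%E.
  under eq_integral do rewrite gee0_abs ?lee_fin//.
  apply/eqP; rewrite eq_le hk_le0 integral_ge0// => x _.
  by rewrite lee_fin.
move/(ae_eq_integral_abs m measurableT mhk): hk => hk.
apply: filterS2 gk hk => x -> /(_ I)[] /eqP; rewrite subr_eq0 => /eqP //.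
Qed.

Section SplitFactorization.
Context (R : realType) (V : finType) (d : V -> measure_display).
Context (X : forall v, measurableType (d v)).
Variable mu : forall v, {sigma_finite_measure set (X v) -> \bar R}.
Variables (A : {set V}) (a0 : config X).
Local Notation iter := (iterated_integral mu).
Implicit Types (x y z : config X) (S T h k : {set V}) (f : config X -> R).

(* The set of [x] with [x_A = a0] need not be measurable, as singletons need not
   be; almost-everywhere statements on it are pulled back along [reset]. *)
Definition reset x : config X := fun v => if v \in A then a0 v else x v.

Lemma measurable_reset : measurable_fun [set: config X] reset.
Proof.
apply: measurable_config => v; rewrite /reset.
by case: (v \in A); [exact: measurable_cst|exact: measurable_coord].
Qed.

Lemma reset_id x : (forall a, a \in A -> x a = a0 a) -> reset x = x.
Proof.
move=> xA; apply: functional_extensionality_dep => v; rewrite /reset.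
by case: ifPn => // vA; rewrite xA.
Qed.

Lemma iterated_integral_reset F :
  iter (enum (~: A)%SET) (F \o reset) a0 = iter (enum (~: A)%SET) F a0.
Proof.
apply: eq_iterated_integral => y ya0 /=; rewrite reset_id// => a aA.
by apply: ya0; rewrite mem_enum inE aA.
Qed.

(** The measure only integrates over configurations that [reset] fixes, so a measurable null set has
    a null preimage. *)
Lemma negligible_reset (N : set (config X)) :
  (intervention_measure mu A a0).-negligible N ->
  (intervention_measure mu A a0).-negligible (reset @^-1` N).
Proof.
case=> B [mB B0 NB]; exists (reset @^-1` B); split; last by move=> x; exact: NB.
  by have := measurable_reset measurableT mB; rewrite setTI.
by rewrite -B0; exact: iterated_integral_reset.
Qed.

(** Where the normalizing integral is 0 or [+oo], [fine] and the inverse yield 0, the same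
    convention as in [conditional]. *)
Definition split_conditional (Psi : {set V} -> config X -> R) S x : R :=
  (fine (iter (enum S) (EFin \o Psi S) x))^-1 * Psi S x.

(** * Products of kernels over chain components and their total mass *)

Section Potentials.
Variables (H : mixed_graph V) (phi : {set V} -> {set V} -> config X -> R).

(** [h] is only a label; the split clique [k] that carries the factor is given separately, because
    distinct cliques of [G] may have the same trace off [A]. *)
Definition split_potentials :=
  forall S h, S \in chain_components H ->
    [/\ measurable_fun setT (phi S h), forall x, 0 <= phi S h x
      & exists2 k, split_clique H S k & depends_only_on k (phi S h)].

Definition split_product S x : R := \prod_(h : {set V}) phi S h x.

Hypothesis phiH : split_potentials.

Lemma split_product_ge0 S x : S \in chain_components H -> 0 <= split_product S x.
Proof. by move=> SH; apply: prodr_ge0 => h _; have [] := phiH h SH. Qed.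

Lemma measurable_split_product S : S \in chain_components H ->
  measurable_fun setT (split_product S).
Proof. by move=> SH; apply: measurable_prod => h _; have [] := phiH h SH. Qed.

Lemma split_product_determined S : S \in chain_components H ->
  determined_by (S :|: parents H S)%SET (split_product S).
Proof.
move=> SH x y xy; apply: eq_bigr => h _.
have [_ _ [k [[w wk wS] kS] dep]] := phiH h SH.
apply: dep => v vk; apply: xy; rewrite finset.in_setU.
have [//|vS/=] := boolP (v \in S).
have vw : v != w by apply: contraNneq vS => ->.
have := kS v w vk wk wS vw; rewrite (negPf vS) => vw'.
by rewrite !inE vS; apply/bigcupP; exists w; rewrite // inE.
Qed.

Local Notation kernel := (split_conditional split_product).

Let product0 S x : S \in chain_components H -> (0 <= (EFin \o split_product S) x)%E.
Proof. by move=> SH; rewrite /= lee_fin split_product_ge0. Qed.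

Let mproduct S : S \in chain_components H ->
  measurable_fun setT (EFin \o split_product S).
Proof. by move=> SH; apply/measurable_EFinP; exact: measurable_split_product. Qed.

Lemma split_conditional_ge0 S x : S \in chain_components H -> 0 <= kernel S x.
Proof.
move=> SH; rewrite mulr_ge0 ?split_product_ge0// invr_ge0 fine_ge0//.
by apply: iterated_integral_ge0 => y; exact: product0.
Qed.

Lemma measurable_split_conditional S : S \in chain_components H ->
  measurable_fun setT (kernel S).
Proof.
move=> SH; apply: measurable_funM; last exact: measurable_split_product.
apply: (measurableT_comp (@measurable_funVr R)).
apply: (measurableT_comp (fine_measurable measurableT)).
by apply: measurable_iterated_integral => [y|]; [exact: product0|exact: mproduct].
Qed.

Lemma split_conditional_determined S : S \in chain_components H ->
  determined_by (S :|: parents H S)%SET (kernel S).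
Proof.
move=> SH x y xy; congr (_^-1 * _); last exact: split_product_determined xy.
congr fine.
apply: (@iterated_integral_determined _ _ _ _ _ _ (S :|: parents H S)%SET).
  by move=> x' y' /(split_product_determined SH) /= ->.
by move=> v vD _; exact: xy.
Qed.

(** The mass is 1 where the normalizing integral is positive and finite, and 0 elsewhere; hence only
    an inequality. *)
Lemma split_conditional_mass S x : S \in chain_components H ->
  (iter (enum S) (EFin \o kernel S) x <= 1)%E.
Proof.
move=> SH; set Z := iter (enum S) (EFin \o split_product S) x.
have Z0 : (0 <= Z)%E by apply: iterated_integral_ge0 => y; exact: product0.
(* The normalizer does not depend on the coordinates in [S], so it is constant in the integral over
   [S]. *)
rewrite (@eq_iterated_integral _ _ _ _ _ _ _
    (fun y => ((fine Z)^-1%:E * (EFin \o split_product S) y)%E)); last first.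
  move=> y yx; rewrite /= -EFinM /split_conditional.
  rewrite (_ : iter (enum S) (EFin \o split_product S) y = Z)//.
  apply: (@iterated_integral_determined _ _ _ _ _ _ [set: V]%SET).
    by move=> y1 y2 y12; congr EFin; apply: split_product_determined => // v _; exact: y12.
  by move=> v _; exact: yx.
rewrite iterated_integralZl//; last 3 first.
- by rewrite lee_fin invr_ge0 fine_ge0.
- by move=> y; exact: product0.
- exact: mproduct.
rewrite -/Z; case: Z Z0 => [r| |] //=; rewrite ?lee_fin => r0.
  by have [->|r00] := eqVneq r 0; rewrite ?mulr0// mulVf.
by rewrite invr0 mul0e.
Qed.

(** Induction on the size of [Q]. For a terminal [S] in [Q], no other kernel depends on the
    coordinates in [S]; integrating these out first leaves a factor at most 1 times the product over
    the rest of [Q]. *)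
Lemma split_total_mass (G : mixed_graph V) (Q : {set {set V}}) s x :
  chain_graph G -> verts G = finset.setT -> H = delete G A ->
  Q \subset chain_components H -> uniq s -> s =i finset.cover Q ->
  (iter s (fun y => (\prod_(S in Q) kernel S y)%:E) x <= 1)%E.
Proof.
move=> chG VG HE.
have mprod (Q' : {set {set V}}) : Q' \subset chain_components H ->
    measurable_fun setT (fun y => (\prod_(S in Q') kernel S y)%:E).
  move=> /fintype.subsetP Q'H; apply/measurable_EFinP.
  rewrite (_ : (fun y => _) = fun y => \prod_(S <- enum Q') kernel S y); last first.
    by apply/funext => y; rewrite big_enum.
  apply: measurable_prod => S; rewrite mem_enum => /Q'H.
  exact: measurable_split_conditional.
have prod0 (Q' : {set {set V}}) y : Q' \subset chain_components H ->
    (0 <= (\prod_(S in Q') kernel S y)%:E)%E.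
  move=> /fintype.subsetP Q'H; rewrite lee_fin prodr_ge0// => S /Q'H SH.
  exact: split_conditional_ge0.
have [n] := ubnP #|Q|; elim: n Q s x => // n IHn Q s x Qn QH us sQ.
have [Q0|Q0] := eqVneq Q finset.set0.
  have -> : s = [::].
    apply: size0nil; apply/eqP; rewrite -leqn0 leqNgt -has_predT.
    by apply/hasP => -[v]; rewrite sQ Q0 /finset.cover big_set0 inE.
  by rewrite /= Q0 big_set0.
have [S SQ SQ'] : exists2 S, S \in Q & forall S', S' \in Q -> S' != S ->
    {in (S' :|: parents H S')%SET, forall v, v \notin S}.
  by move: QH; rewrite HE => QH; exact: terminal_component.
have /fintype.subsetP QHP := QH; have SH := QHP _ SQ.
pose Q' := (Q :\ S)%SET.
have Q'H : Q' \subset chain_components H.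
  by apply/fintype.subsetP => S'; rewrite !inE => /andP[_ /QHP].
have symH : symmetric (und_rel H) by rewrite HE; exact: sym_delete.
(* The coordinates in [S] go to the end of the list, that is, into the innermost integrals. *)
have perm : perm_eq s (enum (finset.cover Q') ++ enum S).
  apply: uniq_perm => //.
    rewrite cat_uniq !enum_uniq andbT/=; apply/hasPn => v; rewrite !mem_enum => vS.
    apply/negP => /bigcupP[S']; rewrite !inE => /andP[S'S S'Q] vS'.
    have vD : v \in (S' :|: parents H S')%SET by rewrite finset.in_setU vS'.
    by have := SQ' _ S'Q S'S v vD; rewrite vS.
  move=> v; rewrite sQ mem_cat !mem_enum; apply/bigcupP/orP.
    move=> [S' S'Q vS']; have [<-|S'S] := eqVneq S' S; first by right.
    by left; apply/bigcupP; exists S'; rewrite // !inE S'S.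
  move=> [/bigcupP[S']|vS]; last by exists S.
  by rewrite !inE => /andP[_ S'Q]; exists S'.
rewrite (perm_iterated_integral _ us perm)//; [|by move=> y; exact: prod0|exact: mprod].
rewrite iterated_integral_cat.
apply: (le_trans _ (IHn Q' (enum (finset.cover Q')) x _ Q'H (enum_uniq _) _)); first last.
- by move=> v; rewrite mem_enum.
- by move: Qn; rewrite (cardsD1 S) SQ.
apply: le_iterated_integral.
- by move=> y; apply: iterated_integral_ge0 => z; exact: prod0.
- by apply: measurable_iterated_integral => [z|]; [exact: prod0|exact: mprod].
- by move=> y; exact: prod0.
- exact: mprod.
move=> y.
rewrite (@eq_iterated_integral _ _ _ _ _ _ _
    (fun z => (\prod_(S' in Q') kernel S' y)%:E * (EFin \o kernel S) z)%E); last first.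
  move=> z zy; rewrite /= -EFinM; congr EFin; rewrite (big_setD1 S)//= mulrC.
  congr (_ * _); apply: eq_bigr => S'; rewrite !inE => /andP[S'S S'Q].
  apply: split_conditional_determined; first exact: QHP.
  by move=> v vS'; apply: zy; rewrite mem_enum; exact: SQ' S'Q S'S v vS'.
rewrite iterated_integralZl; last 3 first.
- exact: prod0.
- by move=> z; rewrite lee_fin split_conditional_ge0.
- by apply/measurable_EFinP; exact: measurable_split_conditional.
rewrite -[X in (_ <= X)%E]mule1; apply: lee_wpmul2l; first exact: prod0.
exact: split_conditional_mass.
Qed.

End Potentials.

(** * Passing between [G] and [delete G A] *)

Lemma prod_components (G : mixed_graph V) (F : {set V} -> R) :
  chain_graph G -> verts G = finset.setT ->
  \prod_(T in chain_components G)
    \prod_(S in chain_components (delete G A) | S \subset T) F S =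
  \prod_(S in chain_components (delete G A)) F S.
Proof.
move=> chG VG.
rewrite (exchange_big_dep [in chain_components (delete G A)])/=; last first.
  by move=> T S _ /andP[].
apply: eq_bigr => S SH.
have [T TG ST] := component_delete_ex chG VG SH.
(* Exactly one component of [G] contains [S], so [S] is counted once. *)
rewrite (big_pred1 T)// => T' /=; rewrite SH /=.
apply/andP/eqP => [[T'G ST']|->//].
have [v vS] := component_neq0 (sym_delete A chG VG) SH.
have [_ symG _ _] := chG.
apply: (component_inj symG T'G TG (u := v)).
  exact: (fintype.subsetP ST').
exact: (fintype.subsetP ST).
Qed.

(** The integral over [T :\: A] splits into blocks, one for each [S] inside [T], because the parents
    of [S] in [H] lie outside [T]. So the normalizer is [c] times the product of those of the
    kernels, and [c] cancels unless it is 0, where the factor vanishes. The product formula is asked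
    only at configurations that the integral visits. *)
Lemma conditional_split (G : mixed_graph V) phi (C : {set {set V}})
    (psi : {set V} -> config X -> R) T (c : R) z :
  chain_graph G -> verts G = finset.setT ->
  split_potentials (delete G A) phi -> T \in chain_components G ->
  (forall h, h \in C -> measurable_fun setT (psi h)) ->
  (forall h x, h \in C -> 0 <= psi h x) -> 0 <= c ->
  (forall y, (forall v, v \notin (T :\: A)%SET -> y v = z v) ->
    \prod_(h in C) psi h y =
    c * \prod_(S in chain_components (delete G A) | S \subset T)
          split_product phi S y) ->
  conditional mu A C T psi z =
  (c != 0)%:R * \prod_(S in chain_components (delete G A) | S \subset T)
                  split_conditional (split_product phi) S z.
Proof.
move=> chG VG phiH TG mpsi psi0 c0 psiE.
have symH := sym_delete A chG VG.
have [_ symG _ _] := chG.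
set H := delete G A in phiH psiE symH *.
pose P := [pred S : {set V} | (S \in chain_components H) && (S \subset T)].
pose Z S := iter (enum S) (EFin \o split_product phi S) z.
have Psi0 S y : S \in chain_components H -> (0 <= (EFin \o split_product phi S) y)%E.
  by move=> SH; rewrite lee_fin (split_product_ge0 phiH).
have mPsi S : S \in chain_components H ->
    measurable_fun setT (EFin \o split_product phi S).
  by move=> SH; apply/measurable_EFinP; exact: measurable_split_product phiH _ SH.
have subTA S : S \in chain_components H -> S \subset T -> S \subset (T :\: A)%SET.
  move=> SH /fintype.subsetP ST; apply/fintype.subsetP => v vS.
  by rewrite inE ST// andbT (component_deleteN chG VG SH).
have ZE : normalizer mu A C T psi z = (c%:E * \prod_(S | P S) Z S)%E.
  rewrite /normalizer integral_prod_measure; last 2 first.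
  - by move=> y; rewrite lee_fin prodr_ge0// => h; exact: psi0.
  - apply/measurable_EFinP.
    rewrite (_ : (fun y => _) = fun y => \prod_(h <- enum C) psi h y); last first.
      by apply/funext => y; rewrite big_enum.
    by apply: measurable_prod => h; rewrite mem_enum; exact: mpsi.
  rewrite (@eq_iterated_integral _ _ _ _ _ _ _
    (fun y => c%:E * \prod_(S | P S) (EFin \o split_product phi S) y)%E); last first.
    move=> y yz; rewrite psiE ?EFinM ?prodEFin// => v vT.
    by apply: yz; rewrite mem_enum.
  rewrite iterated_integralZl ?lee_fin//; last 2 first.
  - by move=> y; apply: prode_ge0 => S /andP[SH _]; exact: Psi0.
  - rewrite (_ : (fun y => _) =
      fun y => (\prod_(S <- enum P) split_product phi S y)%:E); last first.
      by apply/funext => y; rewrite prodEFin big_enum.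
    apply/measurable_EFinP/measurable_prod => S; rewrite mem_enum => /andP[SH _].
    exact: measurable_split_product phiH _ SH.
  congr (_ * _)%E.
  rewrite (@iterated_integral_prod _ _ _ _ _ _ P id
    (fun S => S :|: parents H S)%SET (fun S => EFin \o split_product phi S)).
  - apply: eq_bigr => S /andP[SH ST]; congr (iterated_integral mu _ _ z).
    rewrite /enum_mem -filter_predI; apply: eq_filter => v /=.
    apply/andP/idP => [[]//|vS]; split => //.
    exact: (fintype.subsetP (subTA S SH ST)).
  - exact: enum_uniq.
  - move=> v; rewrite mem_enum inE => /andP[vA vT].
    have vH : v \in verts H by rewrite (verts_delete A VG) inE.
    have [S SH vS] := component_ex symH vH.
    by exists S => //=; rewrite SH (component_delete_sub chG VG SH TG vS vT).
  - by move=> v S S' /andP[SH _] /andP[S'H _]; exact: (component_inj symH SH S'H (u := v)).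
  - by move=> S y /andP[SH _]; exact: Psi0.
  - by move=> S /andP[SH _]; exact: mPsi.
  - by move=> S /andP[SH _] x y xy; congr EFin; exact: split_product_determined xy.
  (* A parent of [S] inside [T] would give an arrow within a chain component of [G]. *)
  move=> S v /andP[SH ST]; rewrite mem_enum inE => /andP[vA vT].
  rewrite finset.in_setU => /orP[//|].
  rewrite inE => /andP[_ /bigcupP[w wS]]; rewrite inE dir_delete// => /and3P[vw _ _].
  by have := component_dir chG TG vT (fintype.subsetP ST _ wS); rewrite vw.
rewrite /conditional ZE psiE; last by move=> v.
have Z0 S : P S -> (0 <= Z S)%E.
  by move=> /andP[SH _]; apply: iterated_integral_ge0 => y; exact: Psi0.
rewrite fineM_ge0 ?lee_fin ?prode_ge0// fine_prod_ge0//=.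
have [->|cN0] := eqVneq c 0; first by rewrite !mul0r mulr0.
rewrite /split_conditional big_split/= prodfV mul1r invfM mulrACA mulVf// mul1r.
by [].
Qed.

Definition split_factorizes (H : mixed_graph V) f :=
  exists2 phi, split_potentials H phi &
    {ae intervention_measure mu A a0, forall x, (forall a, a \in A -> x a = a0 a) ->
       f x = \prod_(S in chain_components H)
               split_conditional (split_product phi) S x}.

(** Each potential [phi S k] is handed to one maximal clique for [T] that contains the split clique
    carrying it, and [psi T h] collects what is handed to [h]. [conditional_split] then applies with
    constant 1. *)
Lemma split_factorizes_factorizes (G : mixed_graph V) f :
  chain_graph G -> verts G = finset.setT ->
  is_density (intervention_measure mu A a0) f ->
  (forall x, (exists2 a, a \in A & x a <> a0 a) -> f x = 0) ->
  split_factorizes (delete G A) f -> factorizes mu A a0 G f.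
Proof.
move=> chG VG df f0 [phi phiH fE]; split => //.
set H := delete G A in phiH fE.
(* [g (T, S, k)] is the clique that receives [phi S k]; the empty set is a placeholder for
   irrelevant triples. *)
have /choice[g gP] : forall p : {set V} * {set V} * {set V}, exists h,
    p.1.1 \in chain_components G -> p.1.2 \in chain_components H ->
    p.1.2 \subset p.1.1 ->
    h \in component_cliques G p.1.1 /\ depends_only_on h (phi p.1.2 p.2).
  move=> [[T S] k] /=.
  have [TG|] := boolP (T \in chain_components G); last by exists finset.set0.
  have [SH|] := boolP (S \in chain_components H); last by exists finset.set0.
  have [ST|] := boolP (S \subset T); last by exists finset.set0.
  have [_ _ [k' k'S dep]] := phiH S k SH.
  have [h hG /fintype.subsetP k'h] := split_clique_extend chG VG SH TG ST k'S.
  by exists h => _ _ _; split => // x y xy; apply: dep => v /k'h; exact: xy.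
pose psi T h x := \prod_(S in chain_components H | S \subset T)
  \prod_(k | g (T, S, k) == h) phi S k x.
have psi0 T h x : 0 <= psi T h x.
  apply: prodr_ge0 => S /andP[SH _]; apply: prodr_ge0 => k _.
  by have [] := phiH S k SH.
have mpsi T h : measurable_fun setT (psi T h).
  rewrite (_ : psi T h = fun x =>
    \prod_(S <- enum [pred S in chain_components H | S \subset T])
    \prod_(k <- enum [pred k | g (T, S, k) == h]) phi S k x); last first.
    apply/funext => x; rewrite big_enum /=; apply: eq_bigr => S _.
    by rewrite big_enum.
  apply: measurable_prod => S; rewrite mem_enum => /andP[SH _].
  by apply: measurable_prod => k _; have [] := phiH S k SH.
exists psi; split.
  move=> T h TG hG; split => // x y xy.
  apply: eq_bigr => S /andP[SH ST]; apply: eq_bigr => k /eqP gk.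
  by have [_] := gP (T, S, k) TG SH ST; apply; rewrite gk.
apply: filterS fE => x fE xA; rewrite fE// -prod_components//.
apply: eq_bigr => T TG.
rewrite (conditional_split (c := 1) chG VG phiH TG)//.
  by rewrite oner_eq0 mul1r.
move=> y _; rewrite mul1r /psi.
rewrite exchange_big /=; apply: eq_bigr => S /andP[SH ST].
(* The potentials of [S] are grouped by the clique that receives them. *)
rewrite /split_product [RHS](partition_big (fun k => g (T, S, k))
  [in component_cliques G T])//= => k _.
by have [] := gP (T, S, k) TG SH ST.
Qed.

Lemma factorizes_split_factorizes (G : mixed_graph V) f :
  chain_graph G -> verts G = finset.setT ->
  factorizes mu A a0 G f -> split_factorizes (delete G A) f.
Proof.
move=> chG VG [[mf f0 intf] fA [psi [psiP fE]]].
set H := delete G A.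
have symH : symmetric (und_rel H) := sym_delete A chG VG.
have [_ symG _ _] := chG.
pose C := component_cliques G.
(* The component of [G] containing [S]; the default is never taken when [S] is a component of
   [H]. *)
pose tau S := odflt finset.set0 [pick T in chain_components G | S \subset T].
have tauE S T : S \in chain_components H -> T \in chain_components G ->
    S \subset T -> tau S = T.
  move=> SH TG ST; rewrite /tau; case: pickP => [T' /andP[T'G ST']|/(_ T)]; last first.
    by rewrite TG ST.
  have [v vS] := component_neq0 symH SH.
  by apply: (component_inj symG T'G TG (u := v));
    [exact: (fintype.subsetP ST')|exact: (fintype.subsetP ST)].
(* A clique of [tau S] that meets [S] gives its potential to [S]. Reading it at [reset x] removes
   the dependence on the coordinates in [A]. *)
pose phi S h x : R :=
  if (h \in C (tau S)) && (h :&: S != finset.set0)%SET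
  then psi (tau S) h (reset x) else 1.
have phiH : split_potentials H phi.
  move=> S h SH; have [T TG ST] := component_delete_ex chG VG SH.
  rewrite /phi (tauE S T SH TG ST).
  have [/andP[hC /finset.set0Pn[w]]|_] := boolP (_ && _).
    rewrite inE => /andP[wh wS].
    have [mpsi psi0 dep] := psiP T h TG hC.
    split; [exact: measurableT_comp mpsi measurable_reset|by []|].
    exists (h :\: A)%SET.
      exact: split_cliqueD (fintype.subsetP ST _ wS).
    move=> x y xy; apply: dep => v vh; rewrite /reset.
    by case: ifPn => // vA; apply: xy; rewrite inE vA.
  (* The constant 1 depends on nothing, so any split clique serves, for instance a singleton in
     [S]. *)
  split => //; have [w wS] := component_neq0 symH SH.
  exists [set w]%SET => //; split; first by exists w; rewrite ?inE.
  by move=> u v /finset.set1P-> /finset.set1P-> _; rewrite eqxx.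
exists phi => //.
pose f' x := \prod_(S in chain_components H)
  split_conditional (split_product phi) S x.
have f'0 x : 0 <= f' x.
  by apply: prodr_ge0 => S; apply: (split_conditional_ge0 phiH).
have mf' : measurable_fun setT f'.
  rewrite (_ : f' = fun x => \prod_(S <- enum (chain_components H))
    split_conditional (split_product phi) S x); last first.
    by apply/funext => x; rewrite big_enum.
  apply: measurable_prod => S; rewrite mem_enum => SH.
  exact: measurable_split_conditional phiH _ SH.
have intf' : (iter (enum (~: A)%SET) (EFin \o f') a0 <= 1)%E.
  apply: (split_total_mass phiH a0 chG VG (erefl _) (fintype.subxx _) (enum_uniq _)).
  by move=> v; rewrite mem_enum cover_components// verts_delete.
have le_f' z : (forall a, a \in A -> z a = a0 a) ->
    \prod_(T in chain_components G) conditional mu A (C T) T (psi T) z <= f' z.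
  move=> zA; rewrite /f' -prod_components//; apply: ler_prod => T TG.
  (* The potentials of cliques missing [T :\: A] stay constant during the integration over
     [T :\: A]; [c] is their product. *)
  pose c := \prod_(h in C T | (h :&: (T :\: A) == finset.set0)%SET) psi T h z.
  rewrite (conditional_split (c := c) chG VG phiH TG); first last.
  - move=> y yz.
    have yA : reset y = y.
      by apply: reset_id => a aA; rewrite yz ?zA// !inE aA.
    rewrite (bigID (fun h => (h :&: (T :\: A) == finset.set0)%SET))/=.
    congr (_ * _).
      apply: eq_bigr => h /andP[hC /eqP h0]; have [_ _ dep] := psiP T h TG hC.
      apply: dep => v vh; apply: yz; apply/negP => vTA.
      by have := finset.in_set0 v; rewrite -h0 inE vh vTA.
    (* With the label [h] outermost, labels outside [C T] and cliques missing [T :\: A] give 1; each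
       other clique meets exactly one [S], which supplies its potential. *)
    rewrite exchange_big/= [RHS](bigID [in C T])/=.
    rewrite [X in _ = _ * X]big1 ?mulr1; last first.
      move=> h hC; rewrite big1// => S /andP[SH ST].
      by rewrite /phi (tauE S T SH TG ST) (negPf hC).
    rewrite [RHS](bigID (fun h => (h :&: (T :\: A) == finset.set0)%SET))/=.
    rewrite [X in _ = X * _]big1 ?mul1r; last first.
      move=> h /andP[hC /eqP h0]; rewrite big1// => S /andP[SH ST].
      rewrite /phi; case: ifPn => // /andP[_ /finset.set0Pn[v]].
      rewrite inE => /andP[vh vS]; have := finset.in_set0 v.
      by rewrite -h0 !inE vh (fintype.subsetP ST _ vS) (component_deleteN chG VG SH vS).
    apply: eq_bigr => h /andP[hC /finset.set0Pn[v]].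
    rewrite !inE => /and3P[vh vA vT].
    have vH : v \in verts H by rewrite (verts_delete A VG) inE.
    have [S SH vS] := component_ex symH vH.
    have ST := component_delete_sub chG VG SH TG vS vT.
    rewrite (bigD1 S) ?SH//= big1 ?mulr1.
      rewrite /phi (tauE S T SH TG ST) hC yA /=; case: ifPn => // /negP; case.
      by apply/finset.set0Pn; exists v; rewrite inE vh.
    move=> S' /andP[/andP[S'H S'T] S'S]; rewrite /phi; case: ifPn => // /andP[_].
    case/finset.set0Pn => w; rewrite inE => /andP[wh wS'].
    case/eqP: S'S; apply: (clique_meets_one chG VG S'H SH TG hC wh wS' _ vh vS vT).
    exact: (fintype.subsetP S'T).
  - by apply: prodr_ge0 => h /andP[hC _]; have [] := psiP T h TG hC.
  - by move=> h x hC; have [] := psiP T h TG hC.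
  - by move=> h hC; have [] := psiP T h TG hC.
  have k0 : 0 <= \prod_(S in chain_components H | S \subset T)
      split_conditional (split_product phi) S z.
    by apply: prodr_ge0 => S /andP[SH _]; apply: (split_conditional_ge0 phiH).
  (* The factor [(c != 0)] is 0 or 1; where it is 0 the bound may be strict. *)
  by case: (c != 0); rewrite ?mul1r ?mul0r k0 lexx.
pose m := prod_measure mu (~: A)%SET a0.
have gf' : {ae m, forall x, f (reset x) <= f' (reset x)}.
  apply: negligibleS (negligible_reset fE) => x /= + fx; apply.
  by rewrite fx ?le_f'// => a aA; rewrite /reset aA.
have int_reset (g : config X -> R) : measurable_fun setT g -> (forall x, 0 <= g x) ->
    (\int[m]_x (g (reset x))%:E = \int[m]_x (g x)%:E)%E.
  move=> mg g0; rewrite [LHS]integral_prod_measure; last 2 first.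
  - by move=> x; rewrite lee_fin.
  - by apply/measurable_EFinP; exact: measurableT_comp mg measurable_reset.
  rewrite [RHS]integral_prod_measure; last 2 first.
  - by move=> x; rewrite lee_fin.
  - exact/measurable_EFinP.
  exact: (iterated_integral_reset (fun x => (g x)%:E)).
(* Composition with [reset] preserves both integrals, so the bound together with mass 1 for [f] and
   at most 1 for [f'] forces equality. *)
have : {ae m, forall x, f (reset x) = f' (reset x)}.
  apply: ae_eq_of_le => //.
  - exact: measurableT_comp mf measurable_reset.
  - exact: measurableT_comp mf' measurable_reset.
  - by rewrite int_reset// [X in (X < _)%E]intf ltry.
  - rewrite !int_reset// [X in (_ <= X)%E]intf integral_prod_measure.
    - exact: intf'.
    - by move=> x; rewrite lee_fin.
    - exact/measurable_EFinP.
by apply: filterS => x fx xA; rewrite reset_id in fx.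
Qed.

End SplitFactorization.

Theorem theorem5 (R : realType) (V : finType) (d : V -> measure_display)
    (X : forall v : V, measurableType (d v))
    (mu : forall v : V, {sigma_finite_measure set (X v) -> \bar R})
    (G1 G2 : mixed_graph V) (A : {set V}) (a0 : config X)
    (hG1 : chain_graph G1) (hG2 : chain_graph G2)
    (hV1 : verts G1 = finset.setT) (hV2 : verts G2 = finset.setT) :
  factorization_equivalent G1 G2 A ->
  same_factorization_decomposition mu A a0 G1 G2.
Proof.
move=> GE f; split=> fG.
  have [df f0 _] := fG; apply: split_factorizes_factorizes => //.
  by rewrite -GE; exact: factorizes_split_factorizes.
have [df f0 _] := fG; apply: split_factorizes_factorizes => //.
by rewrite GE; exact: factorizes_split_factorizes.
Qed.
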